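(* Let $\alpha:\mathbb{C}^2\to\mathbb{R}\times\mathbb{C}=\mathbb{R}^3$ be given by $\alpha(u,v)=\left(\frac{|u|^2}{1+|u|^2+|v|^2},\frac{\bar{u}v}{1+|u|^2+|v|^2}\right)$. Let $(u,v),(u',v')\in\mathbb{C}^*\times\mathbb{C}$ and write $\alpha(u,v)=(x,y,z)$, $\alpha(u',v')=(x',y',z')$. Then $\langle (u,v),(u',v')\rangle=0$ if and only if $(x,y,z)\cdot(x',y',z')=0$ and the vectors $(y,z)$ and $(y',z')$ are linearly dependent over $\mathbb{R}$.
   Context: $\mathbb{R}^3$ is identified with $\mathbb{R}\times\mathbb{C}$ by $(x,y,z)\mapsto(x,y+iz)$. $\mathbb{C}^*=\mathbb{C}\setminus\{0\}$. $\langle\cdot,\cdot\rangle$ is the standard Hermitian inner product on $\mathbb{C}^2$ (linear in the first variable, conjugate linear in the second), $\langle(u,v),(u',v')\rangle=u\overline{u'}+v\overline{v'}$; $\cdot$ is the Euclidean dot product on $\mathbb{R}^3$. *)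

(* Defs.v *)
From mathcomp Require Import all_boot all_order all_algebra.
From mathcomp Require Import spectral complex.
From mathcomp Require Import reals.

Set Implicit Arguments.
Unset Strict Implicit.
Unset Printing Implicit Defensive.

Import Order.TTheory GRing.Theory Num.Theory.

Local Open Scope ring_scope.
Local Open Scope complex_scope.

Definition row2 (K : nmodType) (a b : K) : 'rV[K]_2 :=
  \row_(i < 2) [:: a; b]`_i.

Definition row3 (K : nmodType) (a b c : K) : 'rV[K]_3 :=
  \row_(i < 3) [:: a; b; c]`_i.

(* [Normc.normc] is the modulus with values in [R]; the generic norm of [R[i]]
   takes its values in [R[i]]. *)
Definition alpha (R : realType) (p : R[i] * R[i]) : R * R[i] :=
  let: (u, v) := p in
  let N : R := 1 + Normc.normc u ^+ 2 + Normc.normc v ^+ 2 in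
  (Normc.normc u ^+ 2 / N, u^* * v / N%:C).

(* On ['rV[R[i]]_n] the library form [dotmx] is linear in its first argument
   and conjugate linear in the second: [dotmx p q] is the sum of the
   [p 0 i * (q 0 i)^*]. *)
Definition hermdot (R : realType) (p q : R[i] * R[i]) : R[i] :=
  dotmx (row2 p.1 p.2) (row2 q.1 q.2).

Definition eucldot (R : realType) (n : nat) (a b : 'rV[R]_n) : R :=
  (a *m b^T) 0 0.

Definition linearly_dependent (R : realType) (n : nat) (a b : 'rV[R]_n) : Prop :=
  ~~ free [:: a; b].

(* Main.v *)
(* Multiplying [u * u'^* + v * v'^*] by the nonzero number [u^* * u'] gives
   [N * N' * (x * x' + (y + i z) * (y' - i z'))], where [N] and [N'] are the
   denominators in [alpha].  The real part of the last factor is the Euclidean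
   dot product and its imaginary part is, up to sign, the determinant of the
   vectors [(y, z)] and [(y', z')]. *)
Require Import Defs.
From mathcomp Require Import all_boot all_order all_algebra.
From mathcomp Require Import spectral complex.
From mathcomp Require Import reals.
From mathcomp Require Import ring.

Import Order.TTheory GRing.Theory Num.Theory.

Local Open Scope ring_scope.
Local Open Scope complex_scope.

Lemma eucldot_row3 (R : realType) (a b c a' b' c' : R) :
  eucldot (row3 a b c) (row3 a' b' c') = a * a' + b * b' + c * c'.
Proof.
by rewrite /eucldot mxE !big_ord_recl big_ord0 !mxE /= addr0 !addrA.
Qed.

Lemma hermdotE (R : realType) (p q : R[i] * R[i]) :
  hermdot p q = p.1 * q.1^* + p.2 * q.2^*.
Proof.
by rewrite /hermdot dotmxE mxE !big_ord_recl big_ord0 !mxE /= addr0.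
Qed.

Lemma linearly_dependent_row2P (R : realType) (a b c d : R) :
  linearly_dependent (row2 a b) (row2 c d) <-> b * c - a * d = 0.
Proof.
rewrite /linearly_dependent free_cons span_seq1 seq1_free negb_and !negbK.
have row2_ext (r s : 'rV[R]_2) : r 0 0 = s 0 0 -> r 0 1 = s 0 1 -> r = s.
  move=> e0 e1; apply/rowP => -[[|[|//]] i_lt2].
    by rewrite (_ : Ordinal i_lt2 = 0) //; apply: val_inj.
  by rewrite (_ : Ordinal i_lt2 = 1) //; apply: val_inj.
split=> [/orP[/vlineP[k ek]|/eqP e0] | det0].
- have := congr1 (fun r : 'rV_2 => r 0 0) ek.
  have := congr1 (fun r : 'rV_2 => r 0 1) ek.
  by rewrite !mxE /= => -> ->; ring.
- have := congr1 (fun r : 'rV_2 => r 0 0) e0.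
  have := congr1 (fun r : 'rV_2 => r 0 1) e0.
  by rewrite !mxE /= => -> ->; ring.
have bc_ad : b * c = a * d by apply/eqP; rewrite -subr_eq0 det0.
(* A nonzero coordinate of [row2 c d] fixes the scalar, [a / c] or [b / d]; if both vanish, that
   vector is zero. *)
have [c0|c_neq0] := eqVneq c 0; last first.
  apply/orP; left; apply/vlineP; exists (a / c).
  by apply: row2_ext; rewrite !mxE /= ?divfK // mulrAC -bc_ad mulfK.
have [d0|d_neq0] := eqVneq d 0.
  by apply/orP; right; apply/eqP; apply: row2_ext; rewrite !mxE.
apply/orP; left; apply/vlineP; exists (b / d).
by apply: row2_ext; rewrite !mxE /= ?divfK // mulrAC bc_ad mulfK.
Qed.

(** Clearing the positive denominator [1 + |u|^2 + |v|^2] leaves identities without division, since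
    [u^* * u] is [|u|^2]. *)
Lemma alpha_denom (R : realType) (u v : R[i]) (x y z : R) :
    alpha (u, v) = (x, y +i* z) ->
  exists2 N : R, N != 0 &
    u^* * u = N%:C * x%:C /\ u^* * v = N%:C * (y +i* z).
Proof.
case=> <- <-.
set N := (1 + _ + _).
have N_neq0 : N != 0.
  by rewrite gt_eqF // /N -addrA ltr_pwDl ?ltr01 // addr_ge0 ?sqr_ge0.
exists N => //; split; last by rewrite [RHS]mulrC divfK // fmorph_eq0.
rewrite -[RHS]rmorphM [N * _]mulrC divfK //; case: (u) => a b /=.
rewrite sqr_sqrtr ?addr_ge0 ?sqr_ge0 //; simpc.
by congr (_ +i* _); ring.
Qed.

(* [y +i* z] is the complex number y + iz, so the hypotheses on [alpha] read
   off the coordinates of its values under the identification of R^3 with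
   R x C. *)
Theorem theorem2p5 (R : realType) (u v u' v' : R[i]) (x y z x' y' z' : R)
    (hu : u != 0) (hu' : u' != 0)
    (ha : alpha (u, v) = (x, y +i* z)) (ha' : alpha (u', v') = (x', y' +i* z')) :
  hermdot (u, v) (u', v') = 0 <->
  eucldot (row3 x y z) (row3 x' y' z') = 0 /\
  linearly_dependent (row2 y z) (row2 y' z').
Proof.
rewrite eucldot_row3 hermdotE /=.
have [N N_neq0 [eu ev]] := alpha_denom _ _ _ _ _ _ ha.
have [N' N'_neq0 [eu' ev']] := alpha_denom _ _ _ _ _ _ ha'.
have key : u^* * u' * (u * u'^* + v * v'^*) = (N * N')%:C *
    ((x * x' + y * y' + z * z') +i* (z * y' - y * z')).
  (* Conjugate of [ev']; [N'] is real, so only the sign of [z'] changes. *)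
  have ev'c : u' * v'^* = N'%:C * (y' -i* z').
    by have /(congr1 (@conjc R)) := ev'; rewrite !rmorphM /= conjcK oppr0.
  have -> : u^* * u' * (u * u'^* + v * v'^*) =
    (u^* * u) * (u'^* * u') + (u^* * v) * (u' * v'^*) by ring.
  rewrite eu ev eu' ev'c; simpc.
  by congr (_ +i* _); ring.
(* Both factors in [key] can be cancelled: [(N * N')%:C] for the direct implication, [u^* * u'] for
   the converse. *)
have cu : u^* * u' != 0 by rewrite mulf_neq0 ?conjc_eq0.
have NN' : (N * N')%:C != 0 by rewrite fmorph_eq0 mulf_neq0.
rewrite linearly_dependent_row2P; split=> [h0|[dot0 det0]].
  move/eqP: key; rewrite h0 mulr0 eq_sym mulf_eq0 (negPf NN') /=.
  by rewrite eq_complex /= => /andP[/eqP-> /eqP->].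
apply/eqP; move/eqP: key.
by rewrite dot0 det0 mulr0 mulf_eq0 (negPf cu).
Qed.
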